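(* There exists $\epsilon_0>0$ such that the following holds for every $0<\epsilon<\epsilon_0$. Let $E\subset\mathbb{R}^2$ be a measurable set with $[0,1]^2\subset E\subset[-\epsilon,1+\epsilon]^2$, and assume that $E$ tiles $\mathbb{R}^2$ by translations. Then $E$ also admits a tiling $E+\Lambda=\mathbb{R}^2$ whose translation set $\Lambda$ is a lattice in $\mathbb{R}^2$.
   Context: A measurable set $E\subset\mathbb{R}^n$ with $0<|E|<\infty$ tiles $\mathbb{R}^n$ by translations if there is a discrete set $T\subset\mathbb{R}^n$ such that, up to sets of measure zero, the sets $E+t$, $t\in T$, are pairwise disjoint and their union is $\mathbb{R}^n$; $T$ is then called a translation set. A lattice in $\mathbb{R}^n$ is a set of the form $A\mathbb{Z}^n$ with $A$ an invertible linear map of $\mathbb{R}^n$. *)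

(* Defs.v *)
From HB Require Import structures.
From mathcomp Require Import all_boot all_order all_algebra.
From mathcomp Require Import all_classical all_reals all_analysis.
Set Implicit Arguments. Unset Strict Implicit. Unset Printing Implicit Defensive.
Import Order.TTheory GRing.Theory Num.Theory.
Local Open Scope classical_set_scope.
Local Open Scope ring_scope.

Definition leb2 (R : realType) : set (R * R) -> \bar R :=
  ((@lebesgue_measure R) \x (@lebesgue_measure R))%E.

(* Lebesgue measurable subsets of R^2: measurable for the completion of leb2,
   i.e. differing from a (Borel-product) measurable set by a null set. *)
Definition leb_measurable2 (R : realType) (E : set (R * R)) : Prop :=
  exists B : set (R * R), measurable B /\
    (@leb2 R).-negligible ((E `\` B) `|` (B `\` E)).

Definition shift2 (R : realType) (E : set (R * R)) (t : R * R) : set (R * R) :=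
  [set (x.1 + t.1, x.2 + t.2) | x in E].

Definition discrete2 (R : realType) (T : set (R * R)) : Prop :=
  forall x : R * R, exists r : R, 0 < r /\
    finite_set (T `&` [set y | `|y.1 - x.1| < r /\ `|y.2 - x.2| < r]).

Definition tiles_with (R : realType) (E T : set (R * R)) : Prop :=
  [/\ discrete2 T,
      (forall t t', T t -> T t' -> t <> t' ->
         (@leb2 R).-negligible (shift2 E t `&` shift2 E t')) &
      (@leb2 R).-negligible (~` \bigcup_(t in T) shift2 E t)].

Definition lattice2 (R : realType) (L : set (R * R)) : Prop :=
  exists a b c d : R, a * d - b * c != 0 /\
    L = [set p | exists m n : int,
           p = (a * m%:~R + b * n%:~R, c * m%:~R + d * n%:~R)].

(* Main.v *)
Require Import Defs.
From HB Require Import structures.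
From mathcomp Require Import all_boot all_order all_algebra.
From mathcomp Require Import all_classical all_reals all_analysis.
From mathcomp Require Import ring lra zify.
Import Order.TTheory GRing.Theory Num.Theory.
Local Open Scope classical_set_scope.
Local Open Scope ring_scope.

(** Only finitely many tiles matter.  Up to exchanging the coordinates, the
    tiling contains translates by [a], [b = a + v], [c = a + u], [d = c + v'],
    where [v] and [v'] are nearly [(0, 1)] and [u] and [u' = d - b] are nearly
    [(1, s)] with [|s| <= 1/2].  Put [w = v' - v = u' - u].  In the middle of a
    common edge two neighbouring tiles partition the plane, so the left
    boundary of [E] is locally invariant under [w = u' - u] and the lower
    boundary under [w = v' - v].  Iterating [w] along the left boundary, which
    lies in a thin vertical strip, is impossible if [0 < |w.1|] and
    [|w.2| <= |w.1|]; the lower boundary excludes the other case, so [w = 0].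
    Then the lattice spanned by [u] and [v] works: [u], [v], [u + v], [u - v]
    are differences of translations of the given tiling, which gives
    disjointness, and the parallelogram spanned by the centres of the four
    tiles, a fundamental domain, meets no other tile. *)

(** * Invariance of planar Lebesgue measure, and null sets *)

Local Notation null := (@leb2 _).-negligible.

Definition swap2 {R : realType} (x : R * R) : R * R := (x.2, x.1).

Lemma measurable_shift (R : realType) (c : R) :
  measurable_fun setT (fun x : R => x + c : measurableTypeR R).
Proof. exact: measurable_realfun.measurable_funD. Qed.

Lemma lebesgue_measure_shift (R : realType) (c : R) (A : set R) : measurable A ->
  pushforward (@lebesgue_measure R) (fun x : R => x + c : measurableTypeR R) A
  = lebesgue_measure A.
Proof.
have mf := measurable_shift _ c.
move=> mA; apply/esym/lebesgue_measure_unique => //= _ [[a b]] _ <-.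
rewrite /pushforward.
have -> : (fun x : R => x + c) @^-1` [set` `]a, b]] = [set` `]a - c, b - c]].
  by apply/seteqP; split => x /=; rewrite !in_itv /= ltrBlDr lerBrDr.
rewrite !lebesgue_measure_itv/= !lte_fin ltrD2r; case: ifP => // _.
by rewrite -!EFinB; congr (_%:E); ring.
Qed.

(** Rectangles determine the product measure, so invariance on the line suffices. *)
Lemma leb2_shift (R : realType) (t : R * R) (A : set (R * R)) : measurable A ->
  leb2 ((fun x => (x.1 + t.1, x.2 + t.2)) @^-1` A) = leb2 A.
Proof.
pose f (x : measurableTypeR R * measurableTypeR R) :
  measurableTypeR R * measurableTypeR R := (x.1 + t.1, x.2 + t.2).
have mf : measurable_fun setT f.
  apply: measurable_fun_pair.
  - exact: measurableT_comp (measurable_shift _ t.1) measurable_fst.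
  - exact: measurableT_comp (measurable_shift _ t.2) measurable_snd.
move=> mA; rewrite /leb2; symmetry.
apply: (@product_measure_unique _ _ _ _ R lebesgue_measure lebesgue_measure
  (pushforward (lebesgue_measure \x lebesgue_measure)%E f)) => // B C mB mC.
transitivity ((lebesgue_measure \x lebesgue_measure)%E
  ((fun x : measurableTypeR R => x + t.1 : measurableTypeR R) @^-1` B `*`
   (fun x : measurableTypeR R => x + t.2 : measurableTypeR R) @^-1` C)) => //.
rewrite product_measure1E.
- by congr (_ * _)%E; apply: lebesgue_measure_shift.
- by rewrite -[X in measurable X]setTI; apply: measurable_shift.
- by rewrite -[X in measurable X]setTI; apply: measurable_shift.
Qed.

Lemma leb2_swap (R : realType) (A : set (R * R)) : measurable A ->
  leb2 (swap2 @^-1` A) = leb2 A.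
Proof.
pose f (x : measurableTypeR R * measurableTypeR R) :
  measurableTypeR R * measurableTypeR R := (x.2, x.1).
have mf : measurable_fun setT f.
  by apply: measurable_fun_pair; [exact: measurable_snd|exact: measurable_fst].
move=> mA; rewrite /leb2; symmetry.
apply: (@product_measure_unique _ _ _ _ R lebesgue_measure lebesgue_measure
  (pushforward (lebesgue_measure \x lebesgue_measure)%E f)) => // B C mB mC.
transitivity ((lebesgue_measure \x lebesgue_measure)%E (C `*` B)).
  rewrite /pushforward; congr (product_measure1 _ _ _).
  by apply/seteqP; split => -[x y] [].
by rewrite product_measure1E // muleC.
Qed.

Lemma null_shift (R : realType) (t : R * R) (N : set (R * R)) :
  null N -> null (shift2 N t).
Proof.
move=> [A [mA A0 NA]].
exists ((fun x => (x.1 + (- t.1), x.2 + (- t.2))) @^-1` A); split.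
- rewrite -[X in measurable X]setTI.
  exact: (measurable_fun_pair (measurableT_comp (measurable_shift _ _)
    measurable_fst) (measurableT_comp (measurable_shift _ _) measurable_snd)).
- by rewrite -A0; apply: (leb2_shift _ (- t.1, - t.2)).
- by move=> _ [x Nx <-] /=; rewrite !addrK -surjective_pairing; apply: NA.
Qed.

Lemma null_swap (R : realType) (N : set (R * R)) :
  null N -> null (swap2 @^-1` N).
Proof.
move=> [A [mA A0 NA]]; exists (swap2 @^-1` A); split.
- by rewrite -[X in measurable X]setTI;
  apply: (measurable_fun_pair measurable_snd measurable_fst).
- by rewrite leb2_swap.
- by move=> x; apply: NA.
Qed.

(** An open rectangle has positive measure. This turns almost-everywhere statements into actual
    points. *)
Lemma null_avoid (R : realType) (N : set (R * R)) (a b c d : R) :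
  null N -> a < b -> c < d ->
  exists p : R * R, [/\ a < p.1 < b, c < p.2 < d & ~ N p].
Proof.
move=> nN ab cd; apply: contrapT => nex.
have sub : [set` `]a, b[] `*` [set` `]c, d[] `<=` N.
  move=> p [/=]; rewrite !in_itv /= => pab pcd.
  by apply: contrapT => nNp; apply: nex; exists p.
have mI : measurable (([set` `]a, b[] : set (measurableTypeR R)) `*`
    ([set` `]c, d[] : set (measurableTypeR R))).
  by apply: measurableX; apply: measurable_itv.
have [A [mA A0 NA]] := nN; rewrite /leb2 in A0.
have := le_measure (lebesgue_measure \x lebesgue_measure)%E
  (mem_set mI) (mem_set mA) (subset_trans sub NA).
rewrite [X in (_ <= X)%E -> _]A0 [X in (X <= _)%E -> _]product_measure1E //=.
rewrite !lebesgue_measure_itv /= !lte_fin ab cd.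
rewrite -!EFinB -EFinM lee_fin leNgt => /negP; apply.
by rewrite mulr_gt0 // subr_gt0.
Qed.

Lemma null_sub (R : realType) (A B : set (R * R)) : A `<=` B -> null B -> null A.
Proof. by move=> AB [N [mN N0 BN]]; exists N; split => // x /AB/BN. Qed.

Lemma null_bigcup (R : realType) (F : nat -> set (R * R)) :
  (forall k, null (F k)) -> null (\bigcup_k F k).
Proof.
exact: (@negligible_bigcup _ _ _ (lebesgue_measure \x lebesgue_measure)%E).
Qed.

Lemma null0 (R : realType) : null (set0 : set (R * R)).
Proof.
exact: (@negligible_set0 _ _ _ (lebesgue_measure \x lebesgue_measure)%E).
Qed.

Lemma nullU (R : realType) (A B : set (R * R)) : null A -> null B -> null (A `|` B).
Proof.
exact: (@negligibleU _ _ _ (lebesgue_measure \x lebesgue_measure)%E).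
Qed.

(** * Positions of tiles close to unit squares *)

Definition near_square {R : realType} (e : R) (E : set (R * R)) : Prop :=
  [set p | 0 <= p.1 <= 1 /\ 0 <= p.2 <= 1] `<=` E /\
  E `<=` [set p | - e <= p.1 <= 1 + e /\ - e <= p.2 <= 1 + e].

Definition unit_apart {R : realType} (s t : R * R) : Prop :=
  [\/ s.1 + 1 <= t.1, t.1 + 1 <= s.1, s.2 + 1 <= t.2 | t.2 + 1 <= s.2].

(** What a tiling implies about its translations alone: the inner unit squares do not overlap and
    the enlarged squares cover. *)
Definition near_tiling {R : realType} (e : R) (T : set (R * R)) : Prop :=
  (forall s t, T s -> T t -> s = t \/ unit_apart s t) /\
  (forall p : R * R, exists t, [/\ T t,
    - e <= p.1 - t.1 <= 1 + e & - e <= p.2 - t.2 <= 1 + e]).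

(* The two tiles at [s] and [t] share part of a vertical edge, of length close
   to at least 1/2; 51/100 is 1/2 plus room for the errors of order [e]. *)
Definition hstep {R : realType} (e : R) (s t : R * R) : Prop :=
  1 <= t.1 - s.1 <= 1 + e /\ - (51 / 100) <= t.2 - s.2 <= 51 / 100.

Lemma near_tiling_swap (R : realType) (e : R) (T : set (R * R)) :
  near_tiling e T -> near_tiling e (swap2 @^-1` T).
Proof.
move=> [sepT covT]; split => [s t Ts Tt|p].
  have [|[]] := sepT _ _ Ts Tt.
  - by case: s t {Ts Tt} => [? ?] [? ?] [-> ->]; left.
  - by right; constructor 3.
  - by right; constructor 4.
  - by right; constructor 1.
  - by right; constructor 2.
by have [t [Tt t1 t2]] := covT (swap2 p); exists (swap2 t); case: t Tt t1 t2.
Qed.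

(** The tile [w] covering a point just beyond the upper right corner of [s] is, up to a swap, to the
    right of [s]. Either it is level with [s], or it forces the tile above [s] into alignment. *)
Lemma exists_aligned_pair (R : realType) (e : R) (T : set (R * R)) :
  0 < e -> e < 1 / 1000 -> near_tiling e T ->
  exists s t, T s /\ T t /\
   ((1 <= t.2 - s.2 <= 1 + 3 * e /\ - (3 * e) <= t.1 - s.1 <= 3 * e) \/
    (1 <= t.1 - s.1 <= 1 + 3 * e /\ - (3 * e) <= t.2 - s.2 <= 3 * e)).
Proof.
move=> e0 e1.
have key (U : set (R * R)) (s w : R * R) : near_tiling e U -> U s -> U w ->
    1 <= w.1 - s.1 <= 1 + 3 * e -> e <= w.2 - s.2 <= 1 + 3 * e ->
  exists s t, U s /\ U t /\
   ((1 <= t.2 - s.2 <= 1 + 3 * e /\ - (3 * e) <= t.1 - s.1 <= 3 * e) \/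
    (1 <= t.1 - s.1 <= 1 + 3 * e /\ - (3 * e) <= t.2 - s.2 <= 3 * e)).
  move=> [sepU covU] Us Uw w1 w2.
  have [w3|w3] := lerP (w.2 - s.2) (3 * e).
    by exists s, w; split=> //; split=> //; right; split; lra.
  (* The point is just above the top edge of [s], near its right end. Its tile is blocked by [w] on
     the right, hence sits almost directly above [s]. *)
  have [t [Ut /= t1 t2]] := covU (s.1 + 1 - 2 * e, s.2 + 1 + 2 * e).
  exists s, t; split=> //; split=> //; left.
  have [ts|st] := sepU _ _ Us Ut; first by subst t; lra.
  have [tw|wt] := sepU _ _ Uw Ut; first by subst t; lra.
  by split; case: st => st; case: wt => wt; lra.
move=> nT; have [sepT covT] := nT; have [s [Ts _ _]] := covT (0, 0).
have [w [Tw /= w1 w2]] := covT (s.1 + 1 + 2 * e, s.2 + 1 + 2 * e).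
have [ws|sw] := sepT _ _ Ts Tw; first by subst w; lra.
have [w3|w3] := lerP 1 (w.1 - s.1).
  by apply: (key T s w) => //; lra.
have [[s1 s2] [[t1 t2] [Us [Ut st]]]] : _ :=
  key _ (swap2 s) (swap2 w) (near_tiling_swap _ _ _ nT)
  ltac:(by case: s Ts {w1 w2 sw w3}) ltac:(by case: w Tw {w1 w2 sw w3})
  ltac:(by rewrite /=; case: sw; lra) ltac:(by rewrite /=; lra).
exists (s2, s1), (t2, t1); split=> //; split=> //.
by case: st => -[]; [right|left].
Qed.

(** [c] covers a point just right of the middle of the right edge of [a], and [d] a point just above
    [c]; being unit apart from the earlier tiles pins both. *)
Lemma exists_quadruple (R : realType) (e : R) (T : set (R * R)) (a b : R * R) :
  0 < e -> e < 1 / 1000 -> near_tiling e T -> T a -> T b ->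
  1 <= b.2 - a.2 <= 1 + 3 * e -> - (3 * e) <= b.1 - a.1 <= 3 * e ->
  exists c d, [/\ T c, T d & [/\ hstep (10 * e) a c, hstep (10 * e) b d,
    1 <= d.2 - c.2 <= 1 + 3 * e & - (7 * e) <= d.1 - c.1 <= 7 * e]].
Proof.
move=> e0 e1 [sepT covT] Ta Tb b2 b1.
have [c [Tc /= c1 c2]] := covT (a.1 + 1 + 2 * e, a.2 + 1 / 2).
have [ac|ac] := sepT _ _ Ta Tc; first by subst c; lra.
have {}ac : 1 <= c.1 - a.1 by case: ac; lra.
(* The offset [6 * e] clears the right end of the enlarged square of [b], so [d] differs from
   [b]. *)
have [d [Td /= d1 d2]] := covT (a.1 + 1 + 6 * e, c.2 + 1 + 2 * e).
have [cd|cd] := sepT _ _ Tc Td; first by subst d; lra.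
have {}cd : 1 <= d.2 - c.2 by case: cd; lra.
have [bd|bd] := sepT _ _ Tb Td; first by subst d; lra.
have {}bd : 1 <= d.1 - b.1 by case: bd; lra.
by exists c, d; split=> //; split; rewrite /hstep; lra.
Qed.

(** * From tilings to positions, and the exchange of coordinates *)

Lemma shift2E (R : realType) (E : set (R * R)) (t x : R * R) :
  shift2 E t x <-> E (x - t).
Proof.
split=> [[y Ey <-]|Ext]; last first.
  by exists (x - t) => //=; rewrite !subrK -surjective_pairing.
by rewrite (_ : _ - t = y) //; case: y t {Ey} => [? ?] [? ?]; congr pair => /=; ring.
Qed.

Lemma unit_apartP (R : realType) (e : R) (E : set (R * R)) (s t : R * R) :
  near_square e E -> null (shift2 E s `&` shift2 E t) -> unit_apart s t.
Proof.
move=> [QE _] nul; apply: contrapT => nsep.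
have nsep' : ~ [\/ s.1 + 1 <= t.1, t.1 + 1 <= s.1,
    s.2 + 1 <= t.2 | t.2 + 1 <= s.2] by [].
have ab : Num.max s.1 t.1 < Num.min s.1 t.1 + 1.
  rewrite ltNge; apply/negP => h; apply: nsep'.
  by case: (ltrP s.1 t.1) h => ? ?; [constructor 1|constructor 2]; lra.
have cd : Num.max s.2 t.2 < Num.min s.2 t.2 + 1.
  rewrite ltNge; apply/negP => h; apply: nsep'.
  by case: (ltrP s.2 t.2) h => ? ?; [constructor 3|constructor 4]; lra.
have [p [p1 p2]] := null_avoid _ _ _ _ _ _ nul ab cd; apply.
have p1' : s.1 <= p.1 <= s.1 + 1 /\ t.1 <= p.1 <= t.1 + 1.
  by move: p1; case: (ltrP s.1 t.1) => ? ?; lra.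
have p2' : s.2 <= p.2 <= s.2 + 1 /\ t.2 <= p.2 <= t.2 + 1.
  by move: p2; case: (ltrP s.2 t.2) => ? ?; lra.
by split; apply/shift2E/QE => /=; lra.
Qed.

(* Doubling [e] turns almost every point into every point: a point at distance
   less than [e] from the given one is covered. *)
Lemma near_tiling_of_tiles (R : realType) (e : R) (E T : set (R * R)) :
  0 < e -> near_square e E -> tiles_with E T -> near_tiling (2 * e) T.
Proof.
move=> e0 nE [_ disj cov]; split=> [s t Ts Tt|p].
  have [->|/eqP st] := eqVneq s t; first by left.
  by right; apply: unit_apartP nE _; apply: disj.
have [||q [q1 q2 qU]] := null_avoid _ _ (p.1 - e) (p.1 + e) (p.2 - e) (p.2 + e) cov.
  lra.
  lra.
have [t Tt /shift2E/(proj2 nE) /= qt] : (\bigcup_(t in T) shift2 E t) q.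
  exact: contrapT.
by exists t; split=> //; lra.
Qed.

Lemma tiles_with_swap (R : realType) (E T : set (R * R)) :
  tiles_with E T -> tiles_with (swap2 @^-1` E) (swap2 @^-1` T).
Proof.
have swE (A : set (R * R)) t : shift2 (swap2 @^-1` A) (swap2 t) = swap2 @^-1` shift2 A t.
  by apply/funext => x; apply/propext; rewrite /preimage /= !shift2E.
move=> [dT disj cov]; split.
- move=> x; have [r [r0 fin]] := dT (swap2 x); exists r; split=> //.
  apply: (@sub_finite_set _ _ (swap2 @` (T `&` [set y | `|y.1 - (swap2 x).1| < r /\
     `|y.2 - (swap2 x).2| < r]))); last exact: finite_image.
  by move=> [y1 y2] /= [Ty [h1 h2]]; exists (y2, y1).
- move=> [s1 s2] [t1 t2] Ts Tt st.
  rewrite -[(s1, s2)]/(swap2 (s2, s1)) -[(t1, t2)]/(swap2 (t2, t1)) !swE.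
  apply: (null_swap _ (shift2 E (s2, s1) `&` shift2 E (t2, t1))).
  by apply: disj => // -[? ?]; apply: st; congr pair.
- apply: null_sub (null_swap _ _ cov) => -[x1 x2] /= h [[t1 t2] Tt xt]; apply: h.
  exists (swap2 (t1, t2)) => //.
  by rewrite swE.
Qed.

Lemma near_square_swap (R : realType) (e : R) (E : set (R * R)) :
  near_square e E -> near_square e (swap2 @^-1` E).
Proof.
move=> [QE EQ]; split=> [[x1 x2] /= [? ?]|[x1 x2] /= /EQ []] //.
exact: QE.
Qed.

(** * Local invariance of the boundary of the tile *)

Definition exactly_one {R : realType} (E : set (R * R)) (u p : R * R) : Prop :=
  E p <-> ~ E (p - u).

(* The middle of the edge shared by the tiles at [0] and [u], thickened in the
   horizontal direction: no tile but these two meets it. *)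
Definition side_strip {R : realType} (u : R * R) : set (R * R) :=
  [set p | 1 / 2 <= p.1 <= 3 / 2 /\
    - (14 / 100) <= p.2 - (1 + u.2) / 2 <= 14 / 100].

(** An exceptional point lies in both tiles or in neither. Overlaps are null and, as no third tile
    reaches the strip, points in neither are uncovered. *)
Lemma null_not_exactly_one (R : realType) (e : R) (E T : set (R * R)) (a c : R * R) :
  0 < e -> e < 1 / 1000 -> near_square e E -> tiles_with E T ->
  T a -> T c -> hstep (20 * e) a c ->
  null (side_strip (c - a) `&` ~` exactly_one E (c - a)).
Proof.
move=> e0 e1 nE tE Ta Tc ac.
have [sepT _] := near_tiling_of_tiles _ _ _ _ e0 nE tE.
have [_ disj cov] := tE.
have nac : a <> c by move=> E0; move: ac; rewrite E0 /hstep; lra.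
apply: null_sub (nullU _ _ _ (null_shift _ (- a) _ (disj _ _ Ta Tc nac))
  (null_shift _ (- a) _ cov)) => p [/= [p1 p2] nE1].
have [Ep|nEp] := pselect (E p); [left|right].
  have Ep' : E (p - (c - a)) by apply: contrapT => h; apply: nE1.
  apply/shift2E; split; apply/shift2E; first by rewrite opprK addrK.
  by rewrite opprK -addrA -opprB.
have nEp' : ~ E (p - (c - a)) by move=> h; apply: nE1; split.
apply/shift2E => -[t Tt /shift2E]; rewrite opprK => Ept.
have [ta|nta] := sepT _ _ Ta Tt; first by apply: nEp; rewrite -(addrK a p) {2}ta.
have [tc|ntc] := sepT _ _ Tc Tt.
  by apply: nEp'; rewrite opprB addrA; rewrite tc.
(* A third tile above or below [a] or [c], left of [a] or right of [c] misses the strip, and there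
   is no room between [a] and [c]. *)
move: (proj2 nE _ Ept) ac p1 p2; rewrite /hstep /=.
by case: nta => nta; case: ntc => ntc; lra.
Qed.

(* Otherwise, off a null set, [q \in E] implies [q - (u' - u) \in E] as long as
   [q] stays in the strip; starting inside the unit square, the points
   [q0 - k (u' - u)] remain in [E] forever while moving left without bound. *)
Lemma no_rightward_slide (R : realType) (e : R) (E : set (R * R)) (u u' : R * R) :
  0 < e -> e < 1 / 1000 -> near_square e E ->
  hstep (20 * e) 0 u -> hstep (20 * e) 0 u' ->
  null (side_strip u `&` ~` exactly_one E u) ->
  null (side_strip u' `&` ~` exactly_one E u') ->
  `|u'.2 - u.2| <= u'.1 - u.1 -> u = u'.
Proof.
move=> e0 e1 nE hu hu' nul nul' h12; move: hu hu'; rewrite /hstep /= !subr0 => hu hu'.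
pose d : R * R := u' - u.
have d1 : d.1 = u'.1 - u.1 by [].
have d2 : d.2 = u'.2 - u.2 by [].
have [h2 h3] : - d.1 <= d.2 /\ d.2 <= d.1.
  by move: h12; rewrite ler_norml => /andP[].
have [d0|d0] := ltrP 0 d.1; last first.
  have : d = 0 by rewrite [d]surjective_pairing; congr pair; lra.
  by rewrite /d => /eqP; rewrite subr_eq0 => /eqP.
exfalso.
pose q k (q0 : R * R) : R * R := q0 - (k%:R * d.1, k%:R * d.2).
pose N := (side_strip u `&` ~` exactly_one E u) `|`
          (side_strip u' `&` ~` exactly_one E u').
(* The starting points whose [k]-th iterate, moved by [u], is exceptional. *)
pose Nk k := shift2 (shift2 N (- u)) (k%:R * d.1, k%:R * d.2).
have nulN : null (\bigcup_k Nk k).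
  by apply: null_bigcup => k; do 2!apply: null_shift; exact: nullU.
(* This height centres [q0 + u] in [side_strip u]. Starting at abscissa below 3/100, an iterate
   still in [E] has drifted by at most 3/100 + [e] in each direction, so moved by [u] it stays in
   both strips. *)
pose y0 := (1 - u.2) / 2.
have [||q0 [qx qy qN]] := null_avoid _ _ (2 / 100) (3 / 100) (y0 - 1 / 100)
  (y0 + 1 / 100) nulN.
  lra.
  lra.
have step k : E (q k q0) -> E (q k.+1 q0).
  move=> Eq; have /= [b1 b2] := proj2 nE _ Eq.
  have : ~ N (q k q0 + u).
    move=> h; apply: qN; exists k => //; apply/shift2E/shift2E.
    by rewrite opprK.
  set x := k%:R * d.1 in b1 *; set y := k%:R * d.2 in b2 *.
  have x0 : 0 <= x by rewrite mulr_ge0 // ltW.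
  have [y1 y2] : - x <= y /\ y <= x.
    by split; rewrite /x /y -?mulrN ler_wpM2l ?ler0n.
  have e1' p : (side_strip u p -> exactly_one E u p) /\
      (side_strip u' p -> exactly_one E u' p) <-> ~ N p.
    split=> [[i1 i2] [[/i1]|[/i2]] //|nN]; split=> s; apply: contrapT => h;
      apply: nN; [by left|by right].
  move=> /e1'[i1 i2].
  have s1 : side_strip u (q k q0 + u).
    by rewrite /side_strip /= -/x -/y; move: qx qy; rewrite /y0; lra.
  have s2 : side_strip u' (q k q0 + u).
    by rewrite /side_strip /= -/x -/y; move: qx qy; rewrite /y0; lra.
  (* From [q] in [E], the strip of [u] puts [q + u] outside [E], and the strip of [u'] then puts
     [q + u - u'] in [E]. *)
  have [f1 _] := i1 s1; have [_ f2] := i2 s2.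
  rewrite addrK in f1; have nEp : ~ E (q k q0 + u) by move=> /f1.
  apply: contrapT => nq; apply: nEp; apply: f2 => h; apply: nq; move: h; congr E.
  rewrite /q /d; case: (u) (u') (q0) => [? ?] [? ?] [? ?].
  by congr pair => /=; rewrite -[k.+1]addn1 natrD; ring.
have Ek k : E (q k q0).
  elim: k => [|k /step//]; apply: (proj1 nE) => /=.
  by rewrite !mul0r; move: qx qy; rewrite /y0; lra.
have [k hk] : exists k : nat, (q0.1 + e) / d.1 < k%:R.
  exists (Num.truncn ((q0.1 + e) / d.1)).+1; exact: truncnS_gt.
have /= [h _] := proj2 nE _ (Ek k).
by move: hk; rewrite (ltr_pdivrMr _ _ d0) d1; lra.
Qed.

Lemma no_slide (R : realType) (e : R) (E : set (R * R)) (u u' : R * R) :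
  0 < e -> e < 1 / 1000 -> near_square e E ->
  hstep (20 * e) 0 u -> hstep (20 * e) 0 u' ->
  null (side_strip u `&` ~` exactly_one E u) ->
  null (side_strip u' `&` ~` exactly_one E u') ->
  `|u'.2 - u.2| <= `|u'.1 - u.1| -> u = u'.
Proof.
move=> e0 e1 nE hu hu' nu nu'; have [h|h] := ger0P (u'.1 - u.1) => h12.
  exact: (no_rightward_slide _ _ _ _ _ e0 e1 nE hu hu' nu nu' h12).
apply/esym; apply: (no_rightward_slide _ _ _ _ _ e0 e1 nE hu' hu nu' nu).
by rewrite distrC -[X in _ <= X]opprB.
Qed.

Lemma quadruple_parallelogram (R : realType) (e : R) (E T : set (R * R))
    (a b c d : R * R) :
  0 < e -> e < 1 / 1000 -> near_square e E -> tiles_with E T ->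
  T a -> T b -> T c -> T d ->
  hstep (20 * e) a c -> hstep (20 * e) b d ->
  hstep (20 * e) (swap2 a) (swap2 b) -> hstep (20 * e) (swap2 c) (swap2 d) ->
  d - b = c - a.
Proof.
move=> e0 e1 nE tE Ta Tb Tc Td ac bd ab cd.
have h0 (s t : R * R) : hstep (20 * e) s t -> hstep (20 * e) 0 (t - s).
  by rewrite /hstep /= !subr0.
have [h|/ltW h] := lerP `|(d - b).2 - (c - a).2| `|(d - b).1 - (c - a).1|.
  apply/esym; apply: (no_slide _ _ _ _ _ e0 e1 nE (h0 _ _ ac) (h0 _ _ bd)) h.
  - exact: (null_not_exactly_one _ _ _ _ _ _ e0 e1 nE tE Ta Tc ac).
  - exact: (null_not_exactly_one _ _ _ _ _ _ e0 e1 nE tE Tb Td bd).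
have nE' := near_square_swap _ _ _ nE.
have tE' := tiles_with_swap _ _ _ tE.
have : swap2 b - swap2 a = swap2 d - swap2 c.
  apply: (no_slide _ _ _ _ _ e0 e1 nE' (h0 _ _ ab) (h0 _ _ cd)).
  - apply: (null_not_exactly_one _ _ _ _ _ _ e0 e1 nE' tE' _ _ ab) => //=.
    by case: (a) Ta.
    by case: (b) Tb.
  - apply: (null_not_exactly_one _ _ _ _ _ _ e0 e1 nE' tE' _ _ cd) => //=.
    by case: (c) Tc.
    by case: (d) Td.
  (* Both pairs of opposite sides differ by the same vector. *)
  - have E1 (x y z w : R) : x - y - (z - w) = x - z - (y - w) by ring.
    by move: h; rewrite /= E1 [X in _ <= `|X|]E1.
case=> h2 h1; move: a b c d h1 h2 {Ta Tb Tc Td ac bd ab cd h}.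
move=> [? ?] [? ?] [? ?] [? ?] /= h1 h2.
by congr pair => /=; lra.
Qed.

(** * The tiling by the lattice spanned by two sides *)

Definition lattice_point {R : realType} (u v : R * R) (m n : int) : R * R :=
  (u.1 * m%:~R + v.1 * n%:~R, u.2 * m%:~R + v.2 * n%:~R).

Definition lattice_of {R : realType} (u v : R * R) : set (R * R) :=
  [set p | exists m n : int, p = lattice_point u v m n].

(** A fifth tile would be squeezed vertically between [a] and [a + v], or between [a + u] and
    [a + u + v], where there is no room. *)
Lemma parallelogram_four_tiles (R : realType) (e : R) (T : set (R * R))
    (a u v p t : R * R) (x y : R) :
  0 < e -> e < 1 / 1000 -> near_tiling e T ->
  T a -> T (a + u) -> T (a + v) -> T (a + u + v) ->
  hstep (20 * e) 0 u -> hstep (20 * e) 0 (swap2 v) ->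
  - (3 * e) <= v.1 <= 3 * e ->
  0 <= x <= 1 -> 0 <= y <= 1 ->
  p.1 = a.1 + 1 / 2 + x * u.1 + y * v.1 ->
  p.2 = a.2 + 1 / 2 + x * u.2 + y * v.2 ->
  T t -> - e <= p.1 - t.1 <= 1 + e -> - e <= p.2 - t.2 <= 1 + e ->
  [\/ t = a, t = a + u, t = a + v | t = a + u + v].
Proof.
move=> e0 e1 [sepT _] Ta Tau Tav Tauv; rewrite /hstep /= !subr0 => -[u1 u2] [v2 _] v1.
move=> x01 y01 p1 p2 Tt t1 t2.
have [->|s1] := sepT _ _ Ta Tt; first by constructor 1.
have [->|s2] := sepT _ _ Tau Tt; first by constructor 2.
have [->|s3] := sepT _ _ Tav Tt; first by constructor 3.
have [->|s4] := sepT _ _ Tauv Tt; first by constructor 4.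
exfalso.
clear sepT Ta Tau Tav Tauv Tt.
have xu1 : x <= x * u.1 <= x + 20 * e by clear -e0 e1 u1 x01; nra.
have xu2 : - (51 / 100) * x <= x * u.2 <= 51 / 100 * x by clear -u2 x01; nra.
have xu2' : u.2 - 51 / 100 * (1 - x) <= x * u.2 <= u.2 + 51 / 100 * (1 - x).
  by clear -u2 x01; nra.
have yv1 : - (3 * e) <= y * v.1 <= 3 * e by clear -e0 v1 y01; nra.
have yv2 : y <= y * v.2 <= y + 20 * e by clear -e0 v2 y01; nra.
move: (x * u.1) (x * u.2) (y * v.1) (y * v.2) p1 p2 xu1 xu2 xu2' yv1 yv2.
move=> xu1 xu2 yv1 yv2 p1 p2 h1 h2 h3 h4 h5.
(* When [t] is in the column opposite to the half containing [x], [x] is within [27 * e] of 1/2;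
   hence 53/100 here and 47/100 below. *)
have left_column : t.1 < a.1 + 1 - 3 * e -> x <= 53 / 100 -> False.
  move=> tl xl; clear s2 s4 h3 u1 u2.
  have {}s1 : a.2 + 1 <= t.2 by case: s1; lra.
  case: s3 => /=; lra.
have right_column : a.1 + u.1 - 1 + 3 * e < t.1 -> 47 / 100 <= x -> False.
  move=> tr xr; clear s1 s3 h2 left_column.
  have {}s2 : a.2 + u.2 + 1 <= t.2 by case: s2 => /=; lra.
  case: s4 => /=; lra.
clear s1 s2 s3 s4 h2 h3 h5 p2 t2 v2 u2.
have [xl|xr] := lerP x (1 / 2).
  have [tl|tr] := ltrP t.1 (a.1 + 1 - 3 * e); first by apply: left_column; lra.
  by apply: right_column; lra.
have [tl|tr] := ltrP (a.1 + u.1 - 1 + 3 * e) t.1; first by apply: right_column; lra.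
by apply: left_column; lra.
Qed.

(** The matrix with columns [u], [v] has diagonal entries at least 1, a tiny [v.1], and [u.2] about
    1/2 at most in size. Fixing the signs of [I] and [J] makes the bounds on products linear. *)
Lemma lattice_coordinates_lt2 (R : realType) (e : R) (u v : R * R) (I J : R) :
  0 < e -> e < 1 / 1000 ->
  hstep (20 * e) 0 u -> hstep (20 * e) 0 (swap2 v) ->
  - (3 * e) <= v.1 <= 3 * e ->
  - (1 + 2 * e) <= u.1 * I + v.1 * J <= 1 + 2 * e ->
  - (1 + 2 * e) <= u.2 * I + v.2 * J <= 1 + 2 * e ->
  - 2 < I < 2 /\ - 2 < J < 2.
Proof.
move=> e0 e1; rewrite /hstep /= !subr0 => -[u1 u2] [v2 _] v1 w1 w2.
have [I0|I0] := lerP 0 I; have [J0|J0] := lerP 0 J.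
- have : I <= u.1 * I by
    clear -e0 e1 u1 u2 v1 v2 I0 J0; nra.
  have : - (51 / 100) * I <= u.2 * I <= 51 / 100 * I by
    clear -e0 e1 u1 u2 v1 v2 I0 J0; nra.
  have : - (3 / 1000) * J <= v.1 * J <= 3 / 1000 * J by
    clear -e0 e1 u1 u2 v1 v2 I0 J0; nra.
  have : J <= v.2 * J by
    clear -e0 e1 u1 u2 v1 v2 I0 J0; nra.
  lra.
- have : I <= u.1 * I by
    clear -e0 e1 u1 u2 v1 v2 I0 J0; nra.
  have : - (51 / 100) * I <= u.2 * I <= 51 / 100 * I by
    clear -e0 e1 u1 u2 v1 v2 I0 J0; nra.
  have : 3 / 1000 * J <= v.1 * J <= - (3 / 1000) * J by
    clear -e0 e1 u1 u2 v1 v2 I0 J0; nra.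
  have : v.2 * J <= J by
    clear -e0 e1 u1 u2 v1 v2 I0 J0; nra.
  lra.
- have : u.1 * I <= I by
    clear -e0 e1 u1 u2 v1 v2 I0 J0; nra.
  have : 51 / 100 * I <= u.2 * I <= - (51 / 100) * I by
    clear -e0 e1 u1 u2 v1 v2 I0 J0; nra.
  have : - (3 / 1000) * J <= v.1 * J <= 3 / 1000 * J by
    clear -e0 e1 u1 u2 v1 v2 I0 J0; nra.
  have : J <= v.2 * J by
    clear -e0 e1 u1 u2 v1 v2 I0 J0; nra.
  lra.
- have : u.1 * I <= I by
    clear -e0 e1 u1 u2 v1 v2 I0 J0; nra.
  have : 51 / 100 * I <= u.2 * I <= - (51 / 100) * I by
    clear -e0 e1 u1 u2 v1 v2 I0 J0; nra.
  have : 3 / 1000 * J <= v.1 * J <= - (3 / 1000) * J by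
    clear -e0 e1 u1 u2 v1 v2 I0 J0; nra.
  have : v.2 * J <= J by
    clear -e0 e1 u1 u2 v1 v2 I0 J0; nra.
  lra.
Qed.

Lemma lattice_point_far (R : realType) (e : R) (u v : R * R) (m n : int) :
  0 < e -> e < 1 / 1000 ->
  hstep (20 * e) 0 u -> hstep (20 * e) 0 (swap2 v) ->
  - (3 * e) <= v.1 <= 3 * e ->
  - (1 + 2 * e) <= (lattice_point u v m n).1 <= 1 + 2 * e ->
  - (1 + 2 * e) <= (lattice_point u v m n).2 <= 1 + 2 * e ->
  (m = -1 \/ m = 0 \/ m = 1) /\ (n = -1 \/ n = 0 \/ n = 1).
Proof.
move=> e0 e1 hu hv v1 w1 w2.
have int_lt2 (k : int) : (- 2%:Z)%:~R < k%:~R :> R -> k%:~R < 2%:Z%:~R :> R ->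
    k = -1 \/ k = 0 \/ k = 1.
  by rewrite !ltr_int; clear; lia.
have [/andP[m1 m2] /andP[n1 n2]] :=
  lattice_coordinates_lt2 _ _ _ _ _ _ e0 e1 hu hv v1 w1 w2.
by split; apply: int_lt2.
Qed.

Lemma null_shift_pair (R : realType) (E : set (R * R)) (s t s' t' : R * R) :
  t - s = t' - s' -> null (shift2 E s `&` shift2 E t) ->
  null (shift2 E s' `&` shift2 E t').
Proof.
move=> st /(null_shift _ (s' - s)); apply: null_sub => p [] /shift2E Es /shift2E Et.
have E1 : p - (s' - s) - s = p - s' by rewrite opprB [s - s']addrC addrA addrK.
have E2 : p - (s' - s) - t = p - t'.
  have -> : t' = t + (s' - s) by rewrite -[LHS](subrK s') -st -addrA [- s + _]addrC.
  by rewrite [- (t + _)]opprD addrA addrAC.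
by apply/shift2E; split; apply/shift2E; rewrite ?E1 ?E2.
Qed.

(** Only the eight neighbours of a tile can meet it. Their offsets are [u], [v], [u + v], [u - v] up
    to sign, which the four hypotheses settle. *)
Lemma null_lattice_overlap (R : realType) (e : R) (E : set (R * R))
    (u v l l' : R * R) :
  0 < e -> e < 1 / 1000 -> near_square e E ->
  hstep (20 * e) 0 u -> hstep (20 * e) 0 (swap2 v) ->
  - (3 * e) <= v.1 <= 3 * e ->
  null (shift2 E 0 `&` shift2 E u) -> null (shift2 E 0 `&` shift2 E v) ->
  null (shift2 E 0 `&` shift2 E (u + v)) -> null (shift2 E u `&` shift2 E v) ->
  lattice_of u v l -> lattice_of u v l' -> l <> l' ->
  null (shift2 E l `&` shift2 E l').
Proof.
move=> e0 e1 nE hu hv v1 nu nv nuv nu_v [m [n ->]] [m' [n' ->]] ll'.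
have D : lattice_point u v m' n' - lattice_point u v m n
    = lattice_point u v (m' - m) (n' - n).
  by rewrite /lattice_point; congr pair => /=; rewrite !intrB; ring.
have swp (s t : R * R) : null (shift2 E s `&` shift2 E t) ->
    null (shift2 E t `&` shift2 E s).
  by rewrite setIC.
have [[M N]|far] := pselect ((m' - m = -1 \/ m' - m = 0 \/ m' - m = 1) /\
   (n' - n = -1 \/ n' - n = 0 \/ n' - n = 1)); last first.
  apply: (null_sub _ _ set0) =>
    [p [/shift2E/(proj2 nE) /= p1 /shift2E/(proj2 nE) /= p2]|].
    apply: far; apply: (lattice_point_far _ e u v _ _ e0 e1 hu hv v1);
    by rewrite -D /=; lra.
  exact: null0.
have pr (s t : R * R) : null (shift2 E s `&` shift2 E t) ->
   t - s = lattice_point u v (m' - m) (n' - n) ->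
   null (shift2 E (lattice_point u v m n) `&` shift2 E (lattice_point u v m' n')).
  by move=> nst st; apply: null_shift_pair nst; rewrite D.
case: M N pr => [->|[H|->]] [->|[H'|->]] pr.
- apply: (pr (u + v) 0); first exact: swp.
  by congr pair => /=; ring.
- rewrite H' in pr; apply: (pr u 0); first exact: swp.
  by congr pair => /=; ring.
- apply: (pr u v) => //.
  by congr pair => /=; ring.
- rewrite H in pr; apply: (pr v 0); first exact: swp.
  by congr pair => /=; ring.
- by exfalso; apply: ll'; congr lattice_point; lia.
- rewrite H in pr; apply: (pr 0 v) => //.
  by congr pair => /=; ring.
- apply: (pr v u); first exact: swp.
  by congr pair => /=; ring.
- rewrite H' in pr; apply: (pr 0 u) => //.
  by congr pair => /=; ring.
- apply: (pr 0 (u + v)) => //.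
  by congr pair => /=; ring.
Qed.

Lemma lattice_representative (R : realType) (u v z : R * R) :
  u.1 * v.2 - u.2 * v.1 != 0 ->
  exists (m n : int) (x y : R), [/\ 0 <= x <= 1, 0 <= y <= 1,
    z.1 = x * u.1 + y * v.1 + (lattice_point u v m n).1 &
    z.2 = x * u.2 + y * v.2 + (lattice_point u v m n).2].
Proof.
set D := _ - _ => D0.
pose X := (z.1 * v.2 - z.2 * v.1) / D; pose Y := (u.1 * z.2 - u.2 * z.1) / D.
exists (Num.floor X), (Num.floor Y), (X - (Num.floor X)%:~R), (Y - (Num.floor Y)%:~R).
have fl (r : R) : 0 <= r - (Num.floor r)%:~R <= 1.
  have := floor_le r; have := floorD1_gt r; rewrite intrD; lra.
split=> //=.
- transitivity (X * u.1 + Y * v.1); last by ring.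
  by rewrite /X /Y; rewrite /D in D0 *; field.
- transitivity (X * u.2 + Y * v.2); last by ring.
  by rewrite /X /Y; rewrite /D in D0 *; field.
Qed.

(* The four tiles cover the parallelogram with vertices at their centres. *)
Lemma lattice_tiling (R : realType) (e : R) (E T : set (R * R)) (a u v : R * R) :
  0 < e -> e < 1 / 1000 -> near_square e E -> tiles_with E T -> near_tiling e T ->
  T a -> T (a + u) -> T (a + v) -> T (a + u + v) ->
  hstep (20 * e) 0 u -> hstep (20 * e) 0 (swap2 v) ->
  - (3 * e) <= v.1 <= 3 * e ->
  lattice2 (lattice_of u v) /\ tiles_with E (lattice_of u v).
Proof.
move=> e0 e1 nE [_ disj cov] nT Ta Tau Tav Tauv hu hv v1.
have [hu1 hu2] := hu; have [hv2 _] := hv; rewrite /= !subr0 in hu1 hu2 hv2.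
have det0 : u.1 * v.2 - u.2 * v.1 != 0.
  apply: lt0r_neq0; have : 1 <= u.1 * v.2 by clear -hu1 hv2; nra.
  have : u.2 * v.1 <= 51 / 100 * (3 * e) by clear -hu2 v1 e0; nra.
  by clear -e1; lra.
have step0 (s t w : R * R) : T s -> T (s + w) -> s <> s + w -> 
    null (shift2 E 0 `&` shift2 E w).
  move=> Ts Tsw ns; apply: null_shift_pair (disj _ _ Ts Tsw ns).
  by rewrite subr0 addrC addKr.
have ne (s w : R * R) : 0 < w.1 \/ 0 < w.2 -> s <> s + w.
  move=> w0 h; have h1 := congr1 fst h; have h2 := congr1 snd h.
  by move: w0 h1 h2 => /=; lra.
have nu : null (shift2 E 0 `&` shift2 E u).
  by apply: (step0 a) => //; apply: ne; left; lra.
have nv : null (shift2 E 0 `&` shift2 E v).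
  by apply: (step0 a) => //; apply: ne; right; lra.
have nuv : null (shift2 E 0 `&` shift2 E (u + v)).
  apply: (step0 a) => //; rewrite ?addrA // -addrA.
  by apply: ne; left => /=; lra.
have nu_v : null (shift2 E u `&` shift2 E v).
  apply: null_shift_pair (disj _ _ Tau Tav _).
    by rewrite opprD addrACA subrr add0r.
  by move=> /addrI uv; move: hu1 v1; rewrite uv; lra.
have over l l' : lattice_of u v l -> lattice_of u v l' -> l <> l' ->
    null (shift2 E l `&` shift2 E l').
  exact: (null_lattice_overlap _ _ _ _ _ _ _ e0 e1 nE hu hv v1 nu nv nuv nu_v).
split.
  by exists u.1, v.1, u.2, v.2; rewrite [v.1 * _]mulrC.
split=> //.
  (* Non-overlapping tiles are unit apart, so an open square of side 1 holds at most one lattice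
     point. *)
  move=> x; exists (1 / 2); split; first by lra.
  have [[l [Ll l1 l2]]|nex] := pselect (exists l : R * R, [/\ lattice_of u v l,
      `|l.1 - x.1| < 1 / 2 & `|l.2 - x.2| < 1 / 2]).
    apply: (@sub_finite_set _ _ [set l]); last exact: finite_set1.
    move=> l' [Ll' [l1' l2']] /=; apply: contrapT => ll'.
    have := unit_apartP _ _ _ _ _ nE (over _ _ Ll' Ll ll').
    move: l1 l2 l1' l2'; rewrite !ltr_norml => l1 l2 l1' l2'.
    by case; lra.
  rewrite (_ : _ `&` _ = set0); first exact: finite_set0.
  by rewrite -subset0 => l [Ll [l1 l2]]; apply: nex; exists l.
(* Countably many copies of the part missed by [T], each moved by a lattice point minus [a]. *)
pose F (k : nat) : set (R * R) :=
  if unpickle k is Some mn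
  then shift2 (~` \bigcup_(t in T) shift2 E t) (lattice_point u v mn.1 mn.2 - a)
  else set0.
apply: null_sub (null_bigcup _ F _); last first.
  by move=> k; rewrite /F; case: unpickle => [[m n]|]; [exact: null_shift|exact: null0].
move=> p np.
(* Subtracting (1/2, 1/2) accounts for the parallelogram having its vertices at centres of tiles. *)
have [m [n [x [y [x01 y01 z1 z2]]]]] :=
  lattice_representative _ u v (p - (1 / 2, 1 / 2)) det0.
exists (pickle (m, n)) => //; rewrite /F pickleK; apply/shift2E.
set l := lattice_point u v m n in z1 z2 *.
move=> [t Tt /shift2E Et].
have con (i j : int) : t = a + lattice_point u v i j -> False.
  move=> ti; apply: np; exists (lattice_point u v (m + i) (n + j)).
    by exists (m + i), (n + j).
  apply/shift2E; move: Et; rewrite ti; congr E.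
  rewrite /l /lattice_point; case: (p) (a) => [? ?] [? ?].
  by congr pair => /=; rewrite !intrD; ring.
have [Eb1 Eb2] := proj2 nE _ Et.
have [] := parallelogram_four_tiles _ e T a u v (p - (l - a)) t x y e0 e1 nT
  Ta Tau Tav Tauv
  hu hv v1 x01 y01 _ _ Tt Eb1 Eb2.
- by move: z1 => /=; lra.
- by move: z2 => /=; lra.
- move=> ti; apply: (con 0 0); rewrite ti.
  by case: (a) => [? ?]; congr pair => /=; ring.
- move=> ti; apply: (con 1 0); rewrite ti.
  by case: (a) => [? ?]; congr pair => /=; ring.
- move=> ti; apply: (con 0 1); rewrite ti.
  by case: (a) => [? ?]; congr pair => /=; ring.
- move=> ti; apply: (con 1 1); rewrite ti.
  by case: (a) => [? ?]; congr pair => /=; ring.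
Qed.

(** * Conclusion from a vertical or a horizontal pair *)

Lemma lattice2_swap (R : realType) (L : set (R * R)) :
  lattice2 L -> lattice2 (swap2 @^-1` L).
Proof.
move=> [a [b [c [d [abcd ->]]]]]; exists c, d, a, b; split.
  by rewrite (_ : _ - _ = - (a * d - b * c)) ?oppr_eq0 //; ring.
apply/seteqP; split=> -[x y] [m [n /= xy]]; exists m, n; case: xy => -> ->; by [].
Qed.

(** The near tiling has error [2 * eps], so [3 * e] and [10 * e] for the quadruple become [6 * eps]
    and [20 * eps]. *)
Lemma lattice_tiling_of_vertical_pair (R : realType) (eps : R) (E T : set (R * R))
    (a b : R * R) :
  0 < eps -> eps < 1 / 2000 -> near_square eps E -> tiles_with E T -> T a -> T b ->
  1 <= b.2 - a.2 <= 1 + 6 * eps -> - (6 * eps) <= b.1 - a.1 <= 6 * eps ->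
  exists L : set (R * R), lattice2 L /\ tiles_with E L.
Proof.
move=> e0 e1 nE tE Ta Tb b2 b1.
have nT := near_tiling_of_tiles _ _ _ _ e0 nE tE.
have e0' : 0 < 2 * eps by lra.
have e1' : 2 * eps < 1 / 1000 by lra.
have [||c [d [Tc Td [ac bd d2 d1]]]] :=
  exists_quadruple _ _ _ a b e0' e1' nT Ta Tb.
  lra.
  lra.
have e1000 : eps < 1 / 1000 by lra.
have par : d - b = c - a.
  by apply: (quadruple_parallelogram _ eps E T a b c d) => //;
    move: ac bd; rewrite /hstep /=; lra.
have nE' : near_square (2 * eps) E.
  by split=> [|x /(proj2 nE) /=]; [exact: (proj1 nE)|lra].
exists (lattice_of (c - a) (b - a)).
apply: (lattice_tiling _ _ _ T a _ _ e0' e1' nE' tE nT).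
- by [].
- by rewrite addrC subrK.
- by rewrite addrC subrK.
- by rewrite addrAC [a + _]addrC subrK -par addrC subrK.
- by move: ac; rewrite /hstep /=; lra.
- by rewrite /hstep /=; lra.
- by rewrite /=; lra.
Qed.

Theorem theorem1p2 (R : realType) :
  exists eps0 : R, 0 < eps0 /\
  forall eps : R, 0 < eps -> eps < eps0 ->
  forall E : set (R * R),
    leb_measurable2 E ->
    [set p | 0 <= p.1 <= 1 /\ 0 <= p.2 <= 1] `<=` E ->
    E `<=` [set p | - eps <= p.1 <= 1 + eps /\ - eps <= p.2 <= 1 + eps] ->
    (exists T : set (R * R), tiles_with E T) ->
    exists L : set (R * R), lattice2 L /\ tiles_with E L.
Proof.
(* Half of the bound 1/1000 in the estimates, which are applied to [2 * eps]. *)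
exists (1 / 2000); split; first by lra.
move=> eps e0 e1 E _ QE EQ [T tE].
have nE : near_square eps E by [].
have [||s [t [Ts [Tt [[st2 st1]|[st1 st2]]]]]] :=
  exists_aligned_pair _ (2 * eps) T _ _ (near_tiling_of_tiles _ _ _ _ e0 nE tE).
- lra.
- lra.
- by apply: (lattice_tiling_of_vertical_pair _ eps E T s t) => //; lra.
have [||||L [LL tL]] :=
  lattice_tiling_of_vertical_pair _ eps _ _ (swap2 s) (swap2 t) e0 e1
  (near_square_swap _ _ _ nE) (tiles_with_swap _ _ _ tE).
- by case: s Ts {st1 st2}.
- by case: t Tt {st1 st2}.
- by rewrite /=; lra.
- by rewrite /=; lra.
exists (swap2 @^-1` L); split; first exact: lattice2_swap.
have := tiles_with_swap _ _ _ tL; congr tiles_with.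
by apply/funext => -[x y].
Qed.
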